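(* Let $C_{\mathrm{cusp}}\subset\mathbb{P}^6$ be the 7-cuspidal curve with heptagonal symmetry, and let $\rho:C_{\mathrm{cusp}}^{\mathrm{sm}}\to\mathbb{P}(S^{+})=\mathbb{P}^{15}$ be the spinor map on its smooth locus (both defined in the context). Then $\rho$ extends to an embedding of $C_{\mathrm{cusp}}$ in $\mathbb{P}^{15}$, and $\rho(C_{\mathrm{cusp}})=P_{\mathrm{cusp}}\cap \operatorname{OG}(5,10)$, where $P_{\mathrm{cusp}}=\mathbb{P}(L)$ and $L\subset S^{+}$ is the 7-dimensional subspace spanned by $$-\tfrac35e_{15}+e_{23},\quad \tfrac15e_{25}+e_{34},\quad \tfrac34e_{35}+e_{45},\quad 30\cdot1+e_{1234},\quad \tfrac89e_{1235}+e_{1245},\quad -2e_{12}+e_{1345},\quad -\tfrac{15}{2}e_{14}+e_{2345}.$$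
   Context: Work over $\mathbb{C}$. The curve. The tangent developable of the rational normal curve in $\mathbb{P}^7$ is parametrized by $(s,t,u,v)\mapsto[7s^6u:6s^5tu+s^6v:5s^4t^2u+2s^5tv:4s^3t^3u+3s^4t^2v:3s^2t^4u+4s^3t^3v:2st^5u+5s^2t^4v:t^6u+6st^5v:7t^6v]$ in coordinates $y_0,\dots,y_7$. $C_{\mathrm{cusp}}\subset\mathbb{P}^6$ is its section by $y_7=y_0$; it is the canonically embedded rational curve with seven cusps whose ideal is generated by $f_0=3y_5^2-4y_4y_6+y_3y_0$, $f_1=2y_4y_5-3y_3y_6+y_2y_0$, $f_2=5y_3y_5-8y_2y_6+3y_1y_0$, $f_3=3y_2y_5-5y_1y_6+2y_0^2$, $f_4=5y_4^2-9y_2y_6+4y_1y_0$, $f_5=y_3y_4-2y_1y_6+y_0^2$, $f_6=5y_2y_4-8y_1y_5+3y_0y_6$, $f_7=5y_3^2-9y_1y_5+4y_0y_6$, $f_8=2y_2y_3-3y_1y_4+y_0y_5$, $f_9=3y_2^2-4y_1y_3+y_0y_4$. Use the basis $g_0=-10f_0$, $g_1=15f_1$, $g_2=3f_2$, $g_3=-2f_4$, $g_4=-10f_3+25f_5$, $g_5=f_9$, $g_6=f_8$, $g_7=f_6$, $g_8=f_7$, $g_9=-f_3+2f_5$ of the space of quadrics; it satisfies $\sum_{i=0}^4g_ig_{i+5}=0$. Spinors. Let $V=\mathbb{C}^{10}$ with basis $e_{-1},\dots,e_{-5},e_1,\dots,e_5$, where $e_{-i}$ corresponds to index $i-1$ and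 $e_i$ to index $i+4$ in $\{0,\dots,9\}$, with quadratic form $Q=\sum_{i=1}^5z_{-i}z_i$. Let $U_\infty=\operatorname{Span}(e_1,\dots,e_5)$ and $S^{+}=\bigwedge^{\mathrm{even}}U_\infty$, with basis $e_I=e_{i_1}\wedge\cdots\wedge e_{i_k}$ ($I=\{i_1<\cdots<i_k\}\subset\{1,\dots,5\}$, $k$ even; $1=e_\emptyset$) and coordinates $x_I$ ($x_0=x_\emptyset$). Each $v\in V$ gives an endomorphism $\varphi_v$ of $\bigwedge U_\infty$, linear in $v$: $\varphi_{e_i}$ is left wedging by $e_i$ and $\varphi_{e_{-i}}$ is contraction against $e_i$. A Lagrangian (5-dimensional totally isotropic subspace) $U\subset V$ with $\dim(U\cap U_\infty)$ even has a half spinor $s_U\in S^{+}$, unique up to scalar, characterized by $s_U\neq0$ and $\varphi_u(s_U)=0$ for all $u\in U$. For a smooth point $p\in C_{\mathrm{cusp}}$ let $W_p^\perp\subset V$ be the Lagrangian spanned by the rows $\left(\frac{\partial g_0}{\partial y_i}(p),\dots,\frac{\partial g_9}{\partial y_i}(p)\right)$, $i=0,\dots,6$, and set $\rho(p)=[s_{W_p^\perp}]\in\mathbb{P}(S^{+})$. $\operatorname{OG}(5,10)\subset\mathbb{P}(S^{+})$ is the orthogonal Grassmannian, the subscheme defined by $x_0x_{2345}-x_{23}x_{45}+x_{24}x_{35}-x_{25}x_{34}$, $x_{12}x_{1345}-x_{13}x_{1245}+x_{14}x_{1235}-x_{15}x_{1234}$, $x_0x_{1345}-x_{13}x_{45}+x_{14}x_{35}-x_{15}x_{34}$,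 $x_{12}x_{2345}-x_{23}x_{1245}+x_{24}x_{1235}-x_{25}x_{1234}$, $x_0x_{1245}-x_{12}x_{45}+x_{14}x_{25}-x_{15}x_{24}$, $x_{13}x_{2345}-x_{23}x_{1345}+x_{34}x_{1235}-x_{35}x_{1234}$, $x_0x_{1235}-x_{12}x_{35}+x_{13}x_{25}-x_{15}x_{23}$, $x_{14}x_{2345}-x_{24}x_{1345}+x_{34}x_{1245}-x_{45}x_{1234}$, $x_0x_{1234}-x_{12}x_{34}+x_{13}x_{24}-x_{14}x_{23}$, $x_{15}x_{2345}-x_{25}x_{1345}+x_{35}x_{1245}-x_{45}x_{1235}$. *)

(* Defs.v *)
From mathcomp Require Import all_boot all_order all_algebra.
From mathcomp Require Import mpoly.

Set Implicit Arguments.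
Unset Strict Implicit.
Unset Printing Implicit Defensive.

Import GRing.Theory.
Local Open Scope ring_scope.

(******************************************************************************)
(* Closed subschemes of projective space and their morphisms.                 *)
(*                                                                            *)
(* A closed subscheme of P^(n-1) over an algebraically closed field K is      *)
(* given by a set X of homogeneous polynomials in n variables; intersection   *)
(* of subschemes is union of the sets of equations.  It depends only on the   *)
(* saturation of the homogeneous ideal generated by X.                        *)
(*                                                                            *)
(* Over an open set of the form D(h), a morphism X -> P^(m-1) is given        *)
(* locally by m forms of one degree; multiplying them by a power of h makes   *)
(* the minors comparing two such tuples vanish on all of X.  Hence every      *)
(* morphism of schemes X -> P^(m-1) is given by finitely many m-tuples of     *)
(* forms of equal degree, pairwise proportional on X, at least one of which   *)
(* is nonzero at each point of X, and conversely.                             *)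
(******************************************************************************)
Section Projective.
Variable K : closedFieldType.

Definition equations (n : nat) := {mpoly K[n]} -> Prop.

Definition in_ideal n (X : equations n) (p : {mpoly K[n]}) : Prop :=
  exists (r : nat) (c g : 'I_r -> {mpoly K[n]}),
    (forall i, X (g i)) /\ p = \sum_(i < r) c i * g i.

Definition in_saturation n (X : equations n) (p : {mpoly K[n]}) : Prop :=
  exists N : nat,
    forall m : 'X_{1..n}, mdeg m = N -> in_ideal X ('X_[m] * p).

Definition same_subscheme n (X Y : equations n) : Prop :=
  forall p, in_saturation X p <-> in_saturation Y p.

Definition cap_subscheme n (X Y : equations n) : equations n :=
  fun p => X p \/ Y p.

Definition eval_at n (p : {mpoly K[n]}) (v : 'rV[K]_n) : K :=
  p.@[fun i => v 0 i].

Definition is_point n (X : equations n) (v : 'rV[K]_n) : Prop :=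
  v != 0 /\ forall p, X p -> eval_at p v = 0.

Definition same_point n (v w : 'rV[K]_n) : Prop :=
  exists2 c : K, c != 0 & w = c *: v.

(* P(L), for a linear subspace L of K^n. *)
Definition linear_subscheme n (L : {vspace 'rV[K]_n}) : equations n :=
  fun l => l \is 1.-homog /\ forall v, v \in L -> eval_at l v = 0.

Definition eval_tuple n m (t : m.-tuple {mpoly K[n]}) (v : 'rV[K]_n)
    : 'rV[K]_m :=
  \row_j eval_at (tnth t j) v.

Definition proportional_on n m (X : equations n)
    (t u : m.-tuple {mpoly K[n]}) : Prop :=
  forall i j, in_saturation X (tnth t i * tnth u j - tnth t j * tnth u i).

Definition is_morphism n m (X : equations n)
    (Phi : seq (m.-tuple {mpoly K[n]})) : Prop :=
  [/\ forall t, t \in Phi -> exists d, forall j, tnth t j \is d.-homog,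
      forall t u, t \in Phi -> u \in Phi -> proportional_on X t u
    & forall v, is_point X v -> exists2 t, t \in Phi & eval_tuple t v != 0].

Definition maps_into n m (X : equations n)
    (Phi : seq (m.-tuple {mpoly K[n]})) (Y : equations m) : Prop :=
  forall t G, t \in Phi -> Y G -> in_saturation X (G \mPo t).

Definition has_value n m (Phi : seq (m.-tuple {mpoly K[n]}))
    (v : 'rV[K]_n) (w : 'rV[K]_m) : Prop :=
  exists t, [/\ t \in Phi, eval_tuple t v != 0 & same_point (eval_tuple t v) w].

Definition same_morphism n m (X : equations n)
    (Phi Psi : seq (m.-tuple {mpoly K[n]})) : Prop :=
  forall t u, t \in Phi -> u \in Psi -> proportional_on X t u.

Definition comp_morphism n m k (Psi : seq (k.-tuple {mpoly K[m]}))
    (Phi : seq (m.-tuple {mpoly K[n]})) : seq (k.-tuple {mpoly K[n]}) :=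
  [seq [tuple tnth u j \mPo t | j < k] | u <- Psi, t <- Phi].

Definition id_morphism n : seq (n.-tuple {mpoly K[n]}) :=
  [:: [tuple 'X_j | j < n]].

Definition is_isomorphism n m (X : equations n) (Y : equations m)
    (Phi : seq (m.-tuple {mpoly K[n]})) : Prop :=
  [/\ is_morphism X Phi, maps_into X Phi Y
    & exists Psi : seq (n.-tuple {mpoly K[m]}),
      [/\ is_morphism Y Psi, maps_into Y Psi X,
          same_morphism X (comp_morphism Psi Phi) (id_morphism n)
        & same_morphism Y (comp_morphism Phi Psi) (id_morphism m)]].

(* The scheme-theoretic image of X. *)
Definition image_subscheme n m (X : equations n)
    (Phi : seq (m.-tuple {mpoly K[n]})) : equations m :=
  fun G => (exists d, G \is d.-homog) /\
           forall t, t \in Phi -> in_saturation X (G \mPo t).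

Definition is_embedding n m (X : equations n)
    (Phi : seq (m.-tuple {mpoly K[n]})) : Prop :=
  is_isomorphism X (image_subscheme X Phi) Phi.

Definition jacobian n k (F : k.-tuple {mpoly K[n]}) (v : 'rV[K]_n)
    : 'M[K]_(n, k) :=
  \matrix_(i < n, j < k) eval_at ((tnth F j)^`M(i)) v.

(* Jacobian criterion at a point of the curve cut out by F in P^(n-1):
   the rank is the codimension n - 2. *)
Definition is_smooth_curve_point n k (F : k.-tuple {mpoly K[n]})
    (v : 'rV[K]_n) : Prop :=
  is_point (fun p => p \in F) v /\ \rank (jacobian F v) = (n - 2)%N.

End Projective.

Arguments id_morphism {K} n.

Section CuspidalCurve.
Variable K : closedFieldType.

Definition y_ (k : nat) : {mpoly K[7]} := 'X_(inord k).

Definition f0 := 3 * y_ 5 ^+ 2 - 4 * y_ 4 * y_ 6 + y_ 3 * y_ 0.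
Definition f1 := 2 * y_ 4 * y_ 5 - 3 * y_ 3 * y_ 6 + y_ 2 * y_ 0.
Definition f2 := 5 * y_ 3 * y_ 5 - 8 * y_ 2 * y_ 6 + 3 * y_ 1 * y_ 0.
Definition f3 := 3 * y_ 2 * y_ 5 - 5 * y_ 1 * y_ 6 + 2 * y_ 0 ^+ 2.
Definition f4 := 5 * y_ 4 ^+ 2 - 9 * y_ 2 * y_ 6 + 4 * y_ 1 * y_ 0.
Definition f5 := y_ 3 * y_ 4 - 2 * y_ 1 * y_ 6 + y_ 0 ^+ 2.
Definition f6 := 5 * y_ 2 * y_ 4 - 8 * y_ 1 * y_ 5 + 3 * y_ 0 * y_ 6.
Definition f7 := 5 * y_ 3 ^+ 2 - 9 * y_ 1 * y_ 5 + 4 * y_ 0 * y_ 6.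
Definition f8 := 2 * y_ 2 * y_ 3 - 3 * y_ 1 * y_ 4 + y_ 0 * y_ 5.
Definition f9 := 3 * y_ 2 ^+ 2 - 4 * y_ 1 * y_ 3 + y_ 0 * y_ 4.

(* Generators of the homogeneous ideal of the section y_7 = y_0, in P^6, of the
   tangent developable of the rational normal curve in P^7. *)
Definition cusp_ideal : 10.-tuple {mpoly K[7]} :=
  [tuple f0; f1; f2; f3; f4; f5; f6; f7; f8; f9].

Definition C_cusp : equations K 7 := fun p => p \in cusp_ideal.

Definition is_smooth_C_cusp : 'rV[K]_7 -> Prop :=
  is_smooth_curve_point cusp_ideal.

Definition cusp_quadrics : 10.-tuple {mpoly K[7]} :=
  [tuple - 10 * f0; 15 * f1; 3 * f2; - 2 * f4; - 10 * f3 + 25 * f5;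
         f9; f8; f6; f7; - f3 + 2 * f5].

(* The row space of W_perp p is the subspace W_p^perp of V = K^10. *)
Definition W_perp (p : 'rV[K]_7) : 'M[K]_(7, 10) := jacobian cusp_quadrics p.

End CuspidalCurve.

Section Spinors.
Variable K : closedFieldType.

(* The exterior algebra of U_infinity; the basis vectors e_1, ..., e_5 of
   U_infinity are indexed by 0, ..., 4, and s I is the coefficient of e_I. *)
Definition exterior := {ffun {set 'I_5} -> K^o}.

Definition e_ (I : {set 'I_5}) : exterior := [ffun J => (J == I)%:R].

(* The sign that brings e_i to its place in, or to the front of, e_I. *)
Definition move_sign (i : 'I_5) (I : {set 'I_5}) : K :=
  (-1) ^+ #|[set j in I | (j < i)%N]|.

Definition wedge (i : 'I_5) (s : exterior) : exterior :=
  \sum_(I : {set 'I_5} | i \notin I) (s I * move_sign i I) *: e_ (i |: I).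

Definition contraction (i : 'I_5) (s : exterior) : exterior :=
  \sum_(I : {set 'I_5} | i \in I) (s I * move_sign i I) *: e_ (I :\ i).

(* Coordinates 0..4 of v are those on e_(-1), ..., e_(-5), and coordinates
   5..9 those on e_1, ..., e_5. *)
Definition spin_action (v : 'rV[K]_(5 + 5)) (s : exterior) : exterior :=
  \sum_(i < 5) (v 0 (lshift 5 i) *: contraction i s
                + v 0 (rshift 5 i) *: wedge i s).

(* The coordinates x_I of the half-spin space, in this order, with the
   elements of I numbered from 1. *)
Definition even_lists : 16.-tuple (seq nat) :=
  [tuple [::]; [:: 1; 2]; [:: 1; 3]; [:: 1; 4]; [:: 1; 5]; [:: 2; 3];
         [:: 2; 4]; [:: 2; 5]; [:: 3; 4]; [:: 3; 5]; [:: 4; 5];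
         [:: 1; 2; 3; 4]; [:: 1; 2; 3; 5]; [:: 1; 2; 4; 5]; [:: 1; 3; 4; 5];
         [:: 2; 3; 4; 5]]%N.

Definition even_index (l : seq nat) : 'I_16 := inord (index l even_lists).

Definition even_set (a : 'I_16) : {set 'I_5} :=
  [set i : 'I_5 | i.+1 \in tnth even_lists a].

Definition spinor (x : 'rV[K]_16) : exterior :=
  \sum_(a < 16) x 0 a *: e_ (even_set a).

(* x represents the half spinor of the row space of W. *)
Definition is_half_spinor k (W : 'M[K]_(k, 10)) (x : 'rV[K]_16) : Prop :=
  x != 0 /\ forall u : 'rV[K]_10, (u <= W)%MS -> spin_action u (spinor x) = 0.

(* rho p is the point of P(S^+) represented by x. *)
Definition rho_eq (p : 'rV[K]_7) (x : 'rV[K]_16) : Prop :=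
  is_half_spinor (W_perp p) x.

Definition x_ (l : seq nat) : {mpoly K[16]} := 'X_(even_index l).

Definition OG_quadrics : seq {mpoly K[16]} :=
  let x0 := x_ [::] in
  let x12 := x_ [:: 1; 2]%N in let x13 := x_ [:: 1; 3]%N in
  let x14 := x_ [:: 1; 4]%N in let x15 := x_ [:: 1; 5]%N in
  let x23 := x_ [:: 2; 3]%N in let x24 := x_ [:: 2; 4]%N in
  let x25 := x_ [:: 2; 5]%N in let x34 := x_ [:: 3; 4]%N in
  let x35 := x_ [:: 3; 5]%N in let x45 := x_ [:: 4; 5]%N in
  let x1234 := x_ [:: 1; 2; 3; 4]%N in let x1235 := x_ [:: 1; 2; 3; 5]%N in
  let x1245 := x_ [:: 1; 2; 4; 5]%N in let x1345 := x_ [:: 1; 3; 4; 5]%N in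
  let x2345 := x_ [:: 2; 3; 4; 5]%N in
  [:: x0 * x2345 - x23 * x45 + x24 * x35 - x25 * x34;
      x12 * x1345 - x13 * x1245 + x14 * x1235 - x15 * x1234;
      x0 * x1345 - x13 * x45 + x14 * x35 - x15 * x34;
      x12 * x2345 - x23 * x1245 + x24 * x1235 - x25 * x1234;
      x0 * x1245 - x12 * x45 + x14 * x25 - x15 * x24;
      x13 * x2345 - x23 * x1345 + x34 * x1235 - x35 * x1234;
      x0 * x1235 - x12 * x35 + x13 * x25 - x15 * x23;
      x14 * x2345 - x24 * x1345 + x34 * x1245 - x45 * x1234;
      x0 * x1234 - x12 * x34 + x13 * x24 - x14 * x23;
      x15 * x2345 - x25 * x1345 + x35 * x1245 - x45 * x1235].

Definition OG : equations K 16 := fun p => p \in OG_quadrics.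

Definition eS (l : seq nat) : 'rV[K]_16 := delta_mx 0 (even_index l).

Definition L_cusp_basis : seq 'rV[K]_16 :=
  [:: - (3 / 5) *: eS [:: 1; 5]%N + eS [:: 2; 3]%N;
      (1 / 5) *: eS [:: 2; 5]%N + eS [:: 3; 4]%N;
      (3 / 4) *: eS [:: 3; 5]%N + eS [:: 4; 5]%N;
      30 *: eS [::] + eS [:: 1; 2; 3; 4]%N;
      (8 / 9) *: eS [:: 1; 2; 3; 5]%N + eS [:: 1; 2; 4; 5]%N;
      - 2 *: eS [:: 1; 2]%N + eS [:: 1; 3; 4; 5]%N;
      - (15 / 2) *: eS [:: 1; 4]%N + eS [:: 2; 3; 4; 5]%N].

Definition L_cusp : {vspace 'rV[K]_16} := <<L_cusp_basis>>%VS.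

Definition P_cusp : equations K 16 := linear_subscheme L_cusp.

End Spinors.

Arguments C_cusp K : clear implicits.
Arguments P_cusp K : clear implicits.
Arguments OG K : clear implicits.

(* Main.v *)
(* On C_cusp the spinor map is linear.  The tuple rho of linear forms below
   spans P(L), and the quadrics of OG(5,10) pull back along it to the multiples
   +-150 g_k of the quadrics g_0, ..., g_9; so rho : P^6 -> P(L) is a linear
   isomorphism carrying C_cusp to P(L) /\ OG(5,10).

   With g(y) regarded as a vector of V, the identity phi_{g(y)} rho(y) = 0 holds
   for all y.  Its derivative in the direction of y_i at a point p of C_cusp,
   where the g_k vanish, is phi_u rho(p) = 0 for u the i-th row of W_p^perp.  At
   a smooth point W_p^perp has rank 5, and then only one spinor up to scalars is
   annihilated by it. *)

Require Import Defs.
From mathcomp Require Import all_boot all_order all_algebra.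
From mathcomp Require Import complex mpoly reals ring.

Set Implicit Arguments.
Unset Strict Implicit.
Unset Printing Implicit Defensive.

Import Order.TTheory GRing.Theory Num.Theory.
Local Open Scope ring_scope.

(** * Ideals and substitution *)

Section Ideals.
Variable K : closedFieldType.
Implicit Types (n m k : nat).

Lemma in_ideal0 n (X : equations K n) : in_ideal X 0.
Proof.
exists 0%N, (fun=> 0), (fun=> 0); split; first by case.
by rewrite big_ord0.
Qed.

Lemma in_idealD n (X : equations K n) p q :
  in_ideal X p -> in_ideal X q -> in_ideal X (p + q).
Proof.
case=> r [c [g [Xg ->]]] [s [d [h [Xh ->]]]].
pose pick A (a : 'I_r -> A) (b : 'I_s -> A) (i : 'I_(r + s)) :=
  match fintype.split i with inl j => a j | inr j => b j end.
exists (r + s)%N, (pick _ c d), (pick _ g h); split=> [i|].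
  by rewrite /pick; case: fintype.split.
rewrite big_split_ord; congr (_ + _); apply: eq_bigr => i _; rewrite /pick.
  by rewrite (unsplitK (inl i)).
by rewrite (unsplitK (inr i)).
Qed.

Lemma in_idealM n (X : equations K n) p q :
  in_ideal X q -> in_ideal X (p * q).
Proof.
case=> r [c [g [Xg ->]]]; exists r, (fun i => p * c i), g; split=> //.
by rewrite mulr_sumr; apply: eq_bigr => i _; rewrite mulrA.
Qed.

Lemma in_idealZ n (X : equations K n) (c : K) p :
  in_ideal X p -> in_ideal X (c *: p).
Proof. by move=> Xp; rewrite -mul_mpolyC; apply: in_idealM. Qed.

Lemma in_idealN n (X : equations K n) p : in_ideal X p -> in_ideal X (- p).
Proof. by move=> Xp; rewrite -mulN1r; apply: in_idealM. Qed.

Lemma in_ideal_gen n (X : equations K n) p : X p -> in_ideal X p.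
Proof.
move=> Xp; exists 1%N, (fun=> 1), (fun=> p); split=> //.
by rewrite big_ord1 mul1r.
Qed.

Lemma in_ideal_sum n (X : equations K n) I (r : seq I) (P : pred I) F :
  (forall i, P i -> in_ideal X (F i)) -> in_ideal X (\sum_(i <- r | P i) F i).
Proof.
by move=> XF; apply: big_ind => //; [exact: in_ideal0 | exact: in_idealD].
Qed.

Lemma in_ideal_eval n (X : equations K n) p v :
  is_point X v -> in_ideal X p -> eval_at p v = 0.
Proof.
move=> [_ Xv] [r [c [g [Xg ->]]]]; rewrite /eval_at raddf_sum big1 // => i _.
by have := Xv _ (Xg i); rewrite /eval_at /= mevalM => ->; rewrite mulr0.
Qed.

Lemma in_ideal_comp n m (X : equations K n) (Y : equations K m)
    (t : n.-tuple {mpoly K[m]}) p :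
  (forall g, X g -> in_ideal Y (g \mPo t)) ->
  in_ideal X p -> in_ideal Y (p \mPo t).
Proof.
move=> XY [r [c [g [Xg ->]]]]; rewrite rmorph_sum; apply: in_ideal_sum => i _.
rewrite rmorphM; exact/in_idealM/XY.
Qed.

Lemma in_ideal_mod_prod n (X : equations K n) I (r : seq I) (F G : I -> {mpoly K[n]}) :
  (forall i, in_ideal X (F i - G i)) ->
  in_ideal X (\prod_(i <- r) F i - \prod_(i <- r) G i).
Proof.
move=> XFG; apply: (big_ind2 (fun p q => in_ideal X (p - q))) => // [|p p' q q' Xp Xq].
  by rewrite subrr; apply: in_ideal0.
have -> : p * q - p' * q' = q * (p - p') + p' * (q - q') by ring.
by apply: in_idealD; apply: in_idealM.
Qed.

(* Modulo an ideal containing all the X_i - u_i, the substitution of u for the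
   variables is the identity. *)
Lemma in_ideal_subst n (X : equations K n) (u : n.-tuple {mpoly K[n]}) p :
  (forall i, in_ideal X ('X_i - tnth u i)) -> in_ideal X (p - (p \mPo u)).
Proof.
move=> Xu; rewrite comp_mpolyEX [X in X - _]mpolyE -sumrB.
apply: in_ideal_sum => m _; rewrite -scalerBr; apply: in_idealZ.
rewrite comp_mpolyX mpolyXE_id; apply: in_ideal_mod_prod => i.
rewrite -[m i]card_ord -!prodr_const.
exact: in_ideal_mod_prod.
Qed.

(** * Saturation *)

Lemma mdeg_split n (m : 'X_{1..n}) N :
  (N <= mdeg m)%N -> exists m1 m2 : 'X_{1..n}, m = (m1 + m2)%MM /\ mdeg m1 = N.
Proof.
elim: N => [_|N IH leNm].
  by exists 0%MM, m; rewrite add0m mdeg0.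
have [m1 [m2 [def_m deg_m1]]] := IH (ltnW leNm).
have : mdeg m2 != 0%N.
  by apply: contraTneq leNm => m20; rewrite def_m mdegD m20 addn0 deg_m1 ltnn.
rewrite mdegE sum_nat_eq0 => /forallPn[i /=]; rewrite -lt0n => m2i.
have le_i : (U_(i) <= m2)%MM by rewrite lep1mP -lt0n.
exists (m1 + U_(i))%MM, (m2 - U_(i))%MM; split; last by rewrite mdegD mdeg1 deg_m1 addn1.
by rewrite -addmA [(U_(i) + _)%MM]addmC submK.
Qed.

(** This form is stable under enlarging [N], so two exponents can be replaced by their maximum. *)
Lemma in_saturationP n (X : equations K n) p :
  in_saturation X p <->
  exists N, forall m : 'X_{1..n}, (N <= mdeg m)%N -> in_ideal X ('X_[m] * p).
Proof.
split=> -[N XN]; exists N => m Nm; last by apply: XN; rewrite Nm.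
have [m1 [m2 [-> m1N]]] := mdeg_split Nm.
by rewrite addmC mpolyXD -mulrA; apply/in_idealM/XN.
Qed.

Lemma in_saturation_ideal n (X : equations K n) p :
  in_ideal X p -> in_saturation X p.
Proof. by move=> Xp; exists 0%N => m _; apply: in_idealM. Qed.

Lemma in_saturation0 n (X : equations K n) : in_saturation X 0.
Proof. exact/in_saturation_ideal/in_ideal0. Qed.

Lemma in_saturationD n (X : equations K n) p q :
  in_saturation X p -> in_saturation X q -> in_saturation X (p + q).
Proof.
move=> /in_saturationP[N XN] /in_saturationP[M XM]; apply/in_saturationP.
exists (maxn N M) => m; rewrite geq_max => /andP[Nm Mm].
by rewrite mulrDr; apply: in_idealD; [apply: XN | apply: XM].
Qed.

Lemma in_saturationM n (X : equations K n) p q :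
  in_saturation X q -> in_saturation X (p * q).
Proof.
move=> [N XN]; exists N => m Nm.
by rewrite mulrCA; apply/in_idealM/XN.
Qed.

(* X may be infinite, but only the finitely many elements of X occurring in
   X_m * p for m of degree N matter. *)
Lemma in_saturation_trans n (X Y : equations K n) p :
  (forall g, X g -> in_saturation Y g) -> in_saturation X p -> in_saturation Y p.
Proof.
move=> XY [N XN].
(* The bounded monomials form a finite type, so one exponent can be chosen for each; those of degree
   other than [N] get [0]. *)
have YN (m : 'X_{1..n < N.+1}) : exists M : nat, mdeg m = N ->
    forall m' : 'X_{1..n}, (M <= mdeg m')%N -> in_ideal Y ('X_[m'] * ('X_[m] * p)).
  have [mN|mN] := eqVneq (mdeg m) N; last by exists 0%N => /eqP; rewrite (negPf mN).
  suff /in_saturationP[M YM] : in_saturation Y ('X_[m] * p) by exists M.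
  have [r [c [g [Xg ->]]]] := XN m mN.
  apply: big_ind => [|q q'|i _]; [| exact: in_saturationD |].
    exact: in_saturation0.
  exact/in_saturationM/XY.
have [M YM] := fin_all_exists YN.
(* Splitting off a factor of degree [N] leaves a cofactor whose degree still reaches every chosen
   exponent. *)
apply/in_saturationP; exists (\max_m M m + N)%N => m le_m.
have [m1 [m2 [def_m m1N]]] := mdeg_split (leq_trans (leq_addl _ _) le_m).
have m1lt : (mdeg m1 < N.+1)%N by rewrite m1N.
pose b := BMultinom m1lt.
rewrite def_m addmC mpolyXD -mulrA; apply: (YM b m1N).
have : (\max_m M m <= mdeg m2)%N.
  by move: le_m; rewrite def_m mdegD m1N addnC leq_add2l.
exact/leq_trans/leq_bigmax.
Qed.

Lemma sub_in_saturation n (X Y : equations K n) p :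
  (forall g, X g -> Y g) -> in_saturation X p -> in_saturation Y p.
Proof.
by move=> XY; apply: in_saturation_trans => g /XY /in_ideal_gen/in_saturation_ideal.
Qed.

(** * Composition, evaluation and linear forms *)

Lemma comp_mpolyM n m (t : n.-tuple {mpoly K[m]}) p q :
  (p * q) \mPo t = (p \mPo t) * (q \mPo t).
Proof. exact: rmorphM. Qed.

Lemma comp_mpolyA n m k (t : n.-tuple {mpoly K[m]}) (u : m.-tuple {mpoly K[k]}) p :
  (p \mPo t) \mPo u = p \mPo [tuple tnth t i \mPo u | i < n].
Proof.
rewrite !(comp_mpolyEX p) rmorph_sum; apply: eq_bigr => /= q _.
rewrite comp_mpolyZ !comp_mpolyX rmorph_prod; congr (_ *: _).
by apply: eq_bigr => i _; rewrite rmorphXn tnth_mktuple.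
Qed.

Lemma tnth_comp_mpolyXU n m (t : n.-tuple {mpoly K[m]}) i :
  'X_i \mPo t = tnth t i.
Proof. by rewrite comp_mpolyXU -tnth_nth. Qed.

Lemma eval_at_comp n m (t : n.-tuple {mpoly K[m]}) p v :
  eval_at (p \mPo t) v = eval_at p (eval_tuple t v).
Proof.
rewrite /eval_at comp_mpoly_meval; apply: meval_eq => i.
by rewrite mxE.
Qed.

Lemma eval_mderiv_sum n I (r : seq I) (F : I -> {mpoly K[n]}) i v :
  eval_at (\sum_(j <- r) F j)^`M(i) v = \sum_(j <- r) eval_at (F j)^`M(i) v.
Proof. by rewrite (raddf_sum (mderiv i)) /eval_at raddf_sum. Qed.

Lemma homogXU n (i : 'I_n) : ('X_i : {mpoly K[n]}) \is 1.-homog.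
Proof. by rewrite dhomogX; apply/eqP/mdeg1. Qed.

Lemma linear_formE n (p : {mpoly K[n]}) :
  p \is 1.-homog -> p = \sum_i p@_U_(i) *: 'X_i.
Proof.
move=> hp; apply/mpolyP => m; rewrite raddf_sum /=.
under eq_bigr do rewrite mcoeffZ mcoeffX.
have [/mdeg1P[j /eqP ->]|m1] := boolP (mdeg m == 1%N).
  rewrite (bigD1 j) //= eqxx mulr1 big1 ?addr0 // => i ij.
  by rewrite eq_mnm1 (negPf ij) mulr0.
rewrite (dhomog_nemf_coeff hp) // big1 // => i _.
by rewrite (_ : _ == _ = false) ?mulr0 //; apply: contraNF m1 => /eqP <-; rewrite mdeg1.
Qed.

(** Evaluation at the standard basis vectors reads off the coefficients one at a time. *)
Lemma linear_form_eq0 n (p : {mpoly K[n]}) :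
  p \is 1.-homog -> (forall v, eval_at p v = 0) -> p = 0.
Proof.
move=> /linear_formE -> p0; apply: big1 => j _.
have := p0 (delta_mx 0 j); rewrite /eval_at raddf_sum (bigD1 j) //= big1 => [|i ij].
  by rewrite mevalZ mevalXU mxE !eqxx mulr1 addr0 => ->; rewrite scale0r.
by rewrite mevalZ mevalXU mxE (negPf ij) mulr0.
Qed.

Lemma dhomog_comp_linear n m (t : n.-tuple {mpoly K[m]}) d p :
  (forall i, tnth t i \is 1.-homog) -> p \is d.-homog -> p \mPo t \is d.-homog.
Proof.
move=> ht /dhomogP hp; rewrite comp_mpolyEX big_seq; apply: rpred_sum => q pq.
apply: dhomogZ; have <- : mdeg q = d := hp q pq; rewrite comp_mpolyX mdegE.
apply: (big_ind2 (fun (f : {mpoly K[m]}) k => f \is k.-homog)) => [|f1 k1 f2 k2|i _].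
- exact: dhomog1.
- exact: dhomogM.
- by have := dhomogMn (q i) (ht i); rewrite mul1n.
Qed.

Lemma eval_tuple_linear0 n m (t : m.-tuple {mpoly K[n]}) :
  (forall i, tnth t i \is 1.-homog) -> eval_tuple t 0 = 0.
Proof.
move=> ht; apply/rowP => i; rewrite !mxE (linear_formE (ht i)) /eval_at raddf_sum.
by rewrite big1 // => j _; rewrite /= mevalZ mevalXU mxE mulr0.
Qed.

(** For a single tuple proportionality is commutativity, so only the absence of base points
    remains. *)
Lemma linear_morphism n m (X : equations K n) (t : m.-tuple {mpoly K[n]}) :
  (forall i, tnth t i \is 1.-homog) ->
  (forall v, is_point X v -> eval_tuple t v != 0) -> is_morphism X [:: t].
Proof.
move=> ht nzt; split=> [u|u w|v Xv].
- by rewrite inE => /eqP ->; exists 1%N.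
- rewrite !inE => /eqP -> /eqP -> i j; rewrite mulrC subrr.
  exact: in_saturation0.
- by exists t; rewrite ?mem_head ?nzt.
Qed.

End Ideals.

(** * Spinors annihilated by a five-dimensional space *)

(** Symmetric difference with the singleton of [i]: the move on basis vectors that wedging and
    contraction share. *)
Definition flip (i : 'I_5) (J : {set 'I_5}) : {set 'I_5} :=
  if i \in J then J :\ i else i |: J.

Lemma in_flip i j J : (j \in flip i J) = (j \in J) (+) (j == i).
Proof.
rewrite /flip; case: ifP => iJ; rewrite !inE; case: eqVneq => [->|_] //=.
- by rewrite iJ.
- by rewrite addbF.
- by rewrite iJ.
- by rewrite addbF.
Qed.

Lemma flipK i : involutive (flip i).
Proof. by move=> J; apply/setP => j; rewrite !in_flip -addbA addbb addbF. Qed.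

(* The coordinate of v whose basis vector takes e_(flip i J) to +-e_J. *)
Definition move_coord (i : 'I_5) (J : {set 'I_5}) : 'I_(5 + 5) :=
  if i \in J then rshift 5 i else lshift 5 i.

Section Clifford.
Variable K : closedFieldType.
Implicit Types (s x : exterior K) (v : 'rV[K]_10).

(** The sign counts only elements strictly below [i]. *)
Lemma move_sign_setD1 i (J : {set 'I_5}) : move_sign K i (J :\ i) = move_sign K i J.
Proof.
rewrite /move_sign; congr (_ ^+ _); apply: eq_card => j; rewrite !inE.
by case: eqVneq => [->|]; rewrite ?ltnn ?andbF.
Qed.

Lemma move_sign_setU1 i (J : {set 'I_5}) : move_sign K i (i |: J) = move_sign K i J.
Proof.
rewrite /move_sign; congr (_ ^+ _); apply: eq_card => j; rewrite !inE.
by case: eqVneq => [->|]; rewrite ?ltnn ?andbF.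
Qed.

Lemma move_sign_neq0 i (J : {set 'I_5}) : move_sign K i J != 0.
Proof. by rewrite signr_eq0. Qed.

Lemma wedgeE i s J :
  wedge i s J = if i \in J then move_sign K i J * s (J :\ i) else 0.
Proof.
rewrite sum_ffunE; under eq_bigr do rewrite !ffunE.
case: ifP => iJ.
  rewrite (bigD1 (J :\ i)) ?setD11 //= setD1K // eqxx [_ *: _]mulr1.
  rewrite move_sign_setD1 mulrC big1 ?addr0 // => I /andP[iI neI].
  case: eqP => [defJ|_]; last exact: scaler0.
  by rewrite defJ setU1K ?eqxx in neI.
rewrite big1 // => I _; case: eqP => [defJ|_]; last exact: scaler0.
by rewrite defJ setU11 in iJ.
Qed.

Lemma contractionE i s J :
  contraction i s J = if i \in J then 0 else move_sign K i J * s (i |: J).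
Proof.
rewrite sum_ffunE; under eq_bigr do rewrite !ffunE.
case: ifP => iJ.
  rewrite big1 // => I _; case: eqP => [defJ|_]; last exact: scaler0.
  by rewrite defJ setD11 in iJ.
rewrite (bigD1 (i |: J)) ?setU11 //= setU1K ?iJ // eqxx [_ *: _]mulr1.
rewrite move_sign_setU1 mulrC big1 ?addr0 // => I /andP[iI neI].
case: eqP => [defJ|_]; last exact: scaler0.
by rewrite defJ setD1K ?eqxx in neI.
Qed.

(** For given [i] and [J] only one operation reaches [e_J]: wedging if [i \in J], contraction
    otherwise. *)
Lemma spin_actionE v s J :
  spin_action v s J =
  \sum_(i < 5) v 0 (move_coord i J) * (move_sign K i J * s (flip i J)).
Proof.
rewrite sum_ffunE; apply: eq_bigr => i _.
rewrite !ffunE wedgeE contractionE /move_coord /flip.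
by case: ifP => _; rewrite scaler0 ?add0r ?addr0.
Qed.

Lemma spin_action_subZ v c s x :
  spin_action v (x - c *: s) = spin_action v x - c *: spin_action v s.
Proof.
apply/ffunP => J; rewrite !ffunE !spin_actionE scaler_sumr -sumrB.
apply: eq_bigr => i _; rewrite !ffunE /GRing.scale /=; ring.
Qed.

Lemma spin_actionZ u c (s : exterior K) : spin_action u (c *: s) = c *: spin_action u s.
Proof.
apply/ffunP => J; rewrite !ffunE !spin_actionE scaler_sumr.
apply: eq_bigr => i _; rewrite !ffunE /GRing.scale /=; ring.
Qed.

Lemma spin_action_sum I (r : seq I) (c : I -> K) (v : I -> 'rV[K]_10) s :
  spin_action (\sum_(i <- r) c i *: v i) s = \sum_(i <- r) c i *: spin_action (v i) s.
Proof.
apply/ffunP => J; rewrite spin_actionE sum_ffunE.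
have coefE i : (c i *: spin_action (v i) s) J =
    \sum_(j < 5) c i * (v i 0 (move_coord j J) * (move_sign K j J * s (flip j J))).
  by rewrite ffunE spin_actionE scaler_sumr.
rewrite (eq_bigr _ (fun i _ => coefE i)) exchange_big; apply: eq_bigr => j _.
rewrite summxE mulr_suml; apply: eq_bigr => i _.
by rewrite mxE -mulrA.
Qed.

Section Annihilated.
Variables (k : nat) (W : 'M[K]_(k, 10)).

Definition annihilates s := forall u : 'rV[K]_10, (u <= W)%MS -> spin_action u s = 0.

Lemma annihilates_rows s : (forall i, spin_action (row i W) s = 0) -> annihilates s.
Proof.
move=> Ws u /submxP[w ->]; rewrite mulmx_sum_row spin_action_sum big1 // => i _.
by rewrite Ws scaler0.
Qed.

(* If v annihilates s and its coordinates move_coord i I0 all vanish, then the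
   coefficient of phi_v s at flip i I0 is +- s_I0 times the opposite coordinate,
   so v = 0: these five coordinates are injective on W. *)
Lemma dual_vectors s (I0 : {set 'I_5}) :
  (5 <= \rank W)%N -> annihilates s -> s I0 != 0 ->
  forall j : 'I_5, exists2 v : 'rV[K]_10, (v <= W)%MS &
    forall i, v 0 (move_coord i I0) = (i == j)%:R.
Proof.
move=> rkW Ws sI0 j.
(* Right multiplication by [N] extracts the five coordinates [move_coord i I0]. *)
pose N : 'M[K]_(10, 5) := colsub (move_coord^~ I0) 1%:M.
have mulN m (A : 'M[K]_(m, 10)) : A *m N = colsub (move_coord^~ I0) A.
  by rewrite mulmx_colsub mulmx1.
have kerN : (W :&: kermx N)%MS = 0.
  apply/eqP/rowV0P => v; rewrite sub_capmx => /andP[vW /sub_kermxP vN].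
  have v0 i : v 0 (move_coord i I0) = 0.
    by have /rowP/(_ i) := vN; rewrite mulN !mxE.
  have v1 i : v 0 (move_coord i (flip i I0)) = 0.
    have /ffunP/(_ (flip i I0)) := Ws v vW.
    rewrite spin_actionE (bigD1 i) //= flipK big1 => [|l li].
      rewrite addr0 ffunE => /eqP; rewrite !mulf_eq0 (negPf sI0) orbF.
      by rewrite (negPf (move_sign_neq0 _ _)) orbF => /eqP.
    rewrite /move_coord in_flip (negPf li) addbF.
    by have := v0 l; rewrite /move_coord => ->; rewrite mul0r.
  apply/rowP => a; rewrite mxE -[a](@splitK 5 5).
  case: (@fintype.split 5 5 a) => i /=; have := v0 i; have := v1 i;
    rewrite /move_coord in_flip eqxx addbT; by case: (i \in I0).
(* The kernel of [N] meets the row space of [W] trivially, so the rank does not drop and every unit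
   vector is reached. *)
have rkWN : row_full (W *m N).
  have := mxrank_mul_ker W N; rewrite kerN mxrank0 addn0 /row_full => ->.
  by rewrite eqn_leq rkW andbT -(mxrank_mul_ker W N) kerN mxrank0 addn0 rank_leq_col.
have /submxP[D def_j] : ((delta_mx 0 j : 'rV[K]_5) <= W *m N)%MS by apply: submx_full.
exists (D *m W); first exact: submxMl.
move=> i; have /rowP/(_ i) := def_j; rewrite mulmxA mulN !mxE => <-.
by rewrite eqxx eq_sym.
Qed.

(* Induction on the distance from I to I0: for j in the symmetric difference of
   I and I0 and v the j-th dual vector, the coefficient of phi_v x at flip j I
   relates x_I to coefficients of x closer to I0. *)
Lemma annihilates_eq0 s x (I0 : {set 'I_5}) :
  (5 <= \rank W)%N -> annihilates s -> s I0 != 0 ->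
  annihilates x -> x I0 = 0 -> x = 0.
Proof.
move=> rkW Ws sI0 Wx xI0; apply/ffunP => I; rewrite ffunE.
pose D (J : {set 'I_5}) := [set i | (i \in J) (+) (i \in I0)].
have [d] := ubnP #|D I|; elim: d I => // d IH I leD.
have [DI0|[j Dj]] := set_0Vmem (D I).
  suff -> : I = I0 by [].
  by apply/setP => i; have /setP/(_ i) := DI0; rewrite /D !inE; case: (i \in I); case: (i \in I0).
have [v vW vE] := dual_vectors rkW Ws sI0 j.
have Dflip i J : i \in D J -> D (flip i J) = D J :\ i.
  move=> Di; apply/setP => l; rewrite in_setD1; move: Di; rewrite /D !inE in_flip.
  by case: eqVneq => [->|_ _]; case: (_ \in J); case: (_ \in I0).
have DJ := Dflip j I Dj.
have coordE i : i \notin D (flip j I) -> move_coord i (flip j I) = move_coord i I0.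
  by rewrite /move_coord /D !inE; case: (i \in flip _ _); case: (i \in I0).
have /ffunP/(_ (flip j I)) := Wx v vW; rewrite spin_actionE (bigD1 j) //= flipK big1.
  rewrite addr0 coordE ?DJ ?setD11 // vE eqxx mul1r ffunE => /eqP.
  by rewrite mulf_eq0 (negPf (move_sign_neq0 _ _)) => /eqP.
(* Outside [D (flip j I)] the dual vector has coordinate 0; inside, flipping [i] as well gives a set
   two steps closer to [I0] than [I]. *)
move=> i ij; have [iD|iD] := boolP (i \in D (flip j I)); last first.
  by rewrite coordE // vE (negPf ij) mul0r.
rewrite IH ?mulr0 //; move: leD; rewrite (cardsD1 j) Dj -DJ (cardsD1 i) iD -Dflip //.
by rewrite !add1n => /ltnW.
Qed.

(** Subtracting the multiple of [s] that agrees with [x] at some [I0] in the support of [s] leaves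
    an annihilated spinor that vanishes at [I0]. *)
Lemma annihilates_unique s x :
  (5 <= \rank W)%N -> s != 0 -> annihilates s -> annihilates x ->
  exists c, x = c *: s.
Proof.
move=> rkW s0 Ws Wx.
have [I0 sI0] : exists I, s I != 0.
  apply/existsP; apply: contraR s0 => /existsPn s0.
  by apply/eqP/ffunP => I; rewrite ffunE; apply/eqP; have := s0 I; rewrite negbK.
exists (x I0 / s I0); apply/eqP; rewrite -subr_eq0; apply/eqP.
apply: (annihilates_eq0 rkW Ws sI0) => [u uW|].
  by rewrite spin_action_subZ Ws // Wx // scaler0 subrr.
by rewrite !ffunE /GRing.scale /= divfK ?subrr.
Qed.

End Annihilated.
End Clifford.

(** * Coordinates on the half-spin space *)

(* Subsets of 'I_5 are represented by their bits so that the index of a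
   coordinate is found by computation. *)
Definition set_of (b : seq bool) : {set 'I_5} := [set i : 'I_5 | nth false b i].

Lemma set_ofP (J : {set 'I_5}) : exists b1 b2 b3 b4 b5, J = set_of [:: b1; b2; b3; b4; b5].
Proof.
pose b k := inord k \in J.
exists (b 0%N), (b 1%N), (b 2%N), (b 3%N), (b 4%N).
apply/setP => i; rewrite inE -[in LHS](inord_val i).
by case: i => [[|[|[|[|[|]]]]] ?].
Qed.

(** The fixed size matters: trailing [false] bits do not change the set. *)
Lemma set_of_inj b c : size b = 5%N -> size c = 5%N -> (set_of b == set_of c) = (b == c).
Proof.
move=> szb szc; apply/eqP/eqP => [/setP eqbc|->//].
apply: (@eq_from_nth _ false) => [|i]; first by rewrite szc.
by rewrite szb => lti; have := eqbc (Ordinal lti); rewrite !inE.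
Qed.

Definition toggle (i : nat) (b : seq bool) := set_nth false b i (~~ nth false b i).

Lemma flip_set_of i b : flip i (set_of b) = set_of (toggle i b).
Proof.
apply/setP => j; rewrite in_flip !inE nth_set_nth /= -val_eqE /=.
by case: eqP => [->|_]; rewrite ?addbT ?addbF.
Qed.

Lemma move_sign_set_of (K : closedFieldType) i b :
  size b = 5%N -> move_sign K i (set_of b) = (-1) ^+ count id (take i b).
Proof.
move=> szb; rewrite /move_sign; congr (_ ^+ _).
rewrite -sum1_card big_mkcond !big_ord_recl big_ord0 !inE /=.
case: b szb => [|b0 [|b1 [|b2 [|b3 [|b4 [|]]]]]] //= _.
by case: i => [[|[|[|[|[|]]]]] ?] //=; case: b0 b1 b2 b3 b4 => -[] [] [] [].
Qed.

Definition even_bits : seq (seq bool) :=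
  [seq mkseq (fun i => i.+1 \in l) 5 | l <- even_lists].

Lemma even_set_bits (a : 'I_16) : even_set a = set_of (nth [::] even_bits a).
Proof.
apply/setP => i; rewrite !inE (nth_map [::]) ?size_tuple // nth_mkseq //.
by rewrite (tnth_nth [::]).
Qed.

Lemma eq_set_of_even b (a : 'I_16) : size b = 5%N ->
  (set_of b == even_set a) = (b == nth [::] even_bits a).
Proof.
move=> szb; rewrite even_set_bits set_of_inj //; apply/eqP.
have /allP : all (fun c => size c == 5%N) even_bits by [].
by apply; apply: mem_nth.
Qed.

Lemma even_set_inj : injective even_set.
Proof.
move=> a b /eqP; rewrite {1}even_set_bits eq_set_of_even.
  by rewrite nth_uniq // => /eqP/val_inj.
apply/eqP; have /allP : all (fun c => size c == 5%N) even_bits by [].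
by apply; apply: mem_nth.
Qed.

(** For an odd subset the index is 16, past the end of the tuple, where [nth] returns 0; one formula
    thus covers both parities. *)
Lemma sum_even_set (R : nzRingType) (t : 16.-tuple R) b : size b = 5%N ->
  \sum_(a < 16) tnth t a * (set_of b == even_set a)%:R = nth 0 t (index b even_bits).
Proof.
move=> szb; have sz_bits : size even_bits = 16%N by [].
have [b_even|b_odd] := boolP (b \in even_bits).
  have lt_b : (index b even_bits < 16)%N by rewrite -sz_bits index_mem.
  rewrite (bigD1 (Ordinal lt_b)) //= eq_set_of_even // nth_index // eqxx mulr1.
  rewrite (tnth_nth 0) big1 ?addr0 // => a ne_a; rewrite eq_set_of_even //.
  case: eqP => [def_b|]; last by rewrite mulr0.
  case/eqP: ne_a; apply: ord_inj; change (a = index b even_bits :> nat).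
  by rewrite def_b index_uniq ?sz_bits.
rewrite big1 => [|a _].
  by rewrite memNindex // sz_bits nth_default // size_tuple.
rewrite eq_set_of_even //; case: eqP => [def_b|]; last by rewrite mulr0.
by rewrite def_b mem_nth ?sz_bits in b_odd.
Qed.

Section SpinorCoordinates.
Variable K : closedFieldType.

Lemma spinor_even (x : 'rV[K]_16) a : spinor x (even_set a) = x 0 a.
Proof.
rewrite sum_ffunE (bigD1 a) //= !ffunE eqxx [_ *: _]mulr1 big1 ?addr0 // => b ba.
rewrite !ffunE (inj_eq even_set_inj) eq_sym (negPf ba); exact: scaler0.
Qed.

Lemma spinorZ c (x : 'rV[K]_16) : spinor (c *: x) = c *: spinor x.
Proof. by rewrite scaler_sumr; apply: eq_bigr => a _; rewrite mxE scalerA. Qed.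

Lemma spinor_inj : injective (@spinor K).
Proof. by move=> x y xy; apply/rowP => a; rewrite -!spinor_even xy. Qed.

Lemma spinor_eq0 (x : 'rV[K]_16) : (spinor x == 0) = (x == 0).
Proof.
have s0 : spinor (0 : 'rV[K]_16) = 0 by rewrite -(scale0r (0 : 'rV[K]_16)) spinorZ scale0r.
by rewrite -(inj_eq spinor_inj) s0.
Qed.

End SpinorCoordinates.

(** * The spinor embedding of the cuspidal curve *)

Section CuspidalSpinors.
Variable K : closedFieldType.
Hypothesis char0 : [pchar K] =i pred0.

Local Notation y_ := (y_ K).
Local Notation x_ := (x_ K).
Local Notation C := (C_cusp K).

Lemma natr_neq0 n : n.+1%:R != 0 :> K.
Proof. by have /pcharf0P -> := char0. Qed.

(* The coefficients were found by solving for the half spinor at points of the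
   parametrized curve. *)
Definition rho_tuple : 16.-tuple {mpoly K[7]} :=
  [tuple - 150 * y_ 0; - 30 * y_ 2; 0; - 75 * y_ 3; - 30 * y_ 4; 50 * y_ 4; 0;
         - 30 * y_ 5; - 150 * y_ 5; - 90 * y_ 6; - 120 * y_ 6; - 5 * y_ 0;
         - 8 * y_ 1; - 9 * y_ 1; 15 * y_ 2; 10 * y_ 3].

(** The coefficient of [e_I] in the spinor, kept as a form in y so that it can be differentiated; it
    is 0 for odd [I]. *)
Definition rho_coef (I : {set 'I_5}) : {mpoly K[7]} :=
  \sum_(a < 16) tnth rho_tuple a * (I == even_set a)%:R.

Lemma spinor_rho v I : spinor (eval_tuple rho_tuple v) I = eval_at (rho_coef I) v.
Proof.
rewrite sum_ffunE /eval_at raddf_sum; apply: eq_bigr => a _.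
by rewrite !ffunE mxE /= mevalM rmorph_nat.
Qed.

(* phi_{g(y)} rho(y) = 0, coefficientwise. *)
Lemma cusp_syzygy (J : {set 'I_5}) :
  \sum_(i < 5) tnth (cusp_quadrics K) (move_coord i J) *
     (move_sign K i J *: rho_coef (flip i J)) = 0.
Proof.
have [b1 [b2 [b3 [b4 [b5 ->]]]]] := set_ofP J.
set b := [:: _; _; _; _; _].
(* [F] restates the summand through bits and [nth], so that concrete bits compute to explicit
   polynomials. *)
pose F (i : nat) : {mpoly K[7]} := nth 0 (cusp_quadrics K) (if nth false b i then 5 + i else i)%N *
  ((-1) ^+ count id (take i b) * nth 0 rho_tuple (index (toggle i b) even_bits)).
have FE (i : 'I_5) : tnth (cusp_quadrics K) (move_coord i (set_of b)) *
     (move_sign K i (set_of b) *: rho_coef (flip i (set_of b))) = F i.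
  rewrite /F move_sign_set_of // flip_set_of /rho_coef sum_even_set; last first.
    by case: i => [[|[|[|[|[|]]]]] ?].
  rewrite (tnth_nth 0) -mul_mpolyC rmorphXn rmorphN1 /move_coord inE.
  by case: (nth false b i).
rewrite (eq_bigr _ (fun i _ => FE i)) {FE} !big_ord_recl big_ord0 /= /bump /=; rewrite {}/F {}/b.
(* For even [J] only coefficients at odd sets occur, and they are 0; the odd [J] give sixteen cubic
   identities. *)
case: b1 b2 b3 b4 b5 => -[] [] [] [] /=.
all: rewrite /f0 /f1 /f2 /f3 /f4 /f5 /f6 /f7 /f8 /f9.
all: move: (y_ 0) (y_ 1) (y_ 2) (y_ 3) (y_ 4) (y_ 5) (y_ 6) => y0 y1 y2 y3 y4 y5 y6.
all: ring.
Qed.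

(** Each y_j is read off one coordinate of [rho_tuple] that is a multiple of it, namely one where a
    basis vector of L has coefficient 1. *)
Definition rho_inv : 7.-tuple {mpoly K[16]} :=
  [tuple (- 5)^-1 *: x_ [:: 1; 2; 3; 4]%N; (- 9)^-1 *: x_ [:: 1; 2; 4; 5]%N;
         15^-1 *: x_ [:: 1; 3; 4; 5]%N; 10^-1 *: x_ [:: 2; 3; 4; 5]%N;
         50^-1 *: x_ [:: 2; 3]%N; (- 150)^-1 *: x_ [:: 3; 4]%N;
         (- 120)^-1 *: x_ [:: 4; 5]%N].

Lemma scaler_natM (p : {mpoly K[7]}) (c : K) n : c *: (n%:R * p) = (c * n%:R) *: p.
Proof. by rewrite mulr_natl -scaler_nat scalerA. Qed.

Lemma x_comp l : l \in (even_lists : seq (seq nat)) ->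
  x_ l \mPo rho_tuple = nth 0 rho_tuple (index l even_lists).
Proof.
move=> l_even; rewrite comp_mpolyXU inordK // -[X in (_ < X)%N](size_tuple even_lists).
by rewrite index_mem.
Qed.

Lemma rho_invK j : tnth rho_inv j \mPo rho_tuple = 'X_j.
Proof.
have yE k (lt_k : (k < 7)%N) : y_ k = 'X_(Ordinal lt_k).
  by congr mpolyX; congr mnm1; apply: val_inj; rewrite /= inordK.
have invnK n p : (n.+1%:R : K)^-1 *: (n.+1%:R * p) = p :> {mpoly K[7]}.
  by rewrite scaler_natM mulVf ?natr_neq0 // scale1r.
have invNK n p : (- n.+1%:R : K)^-1 *: (- n.+1%:R * p) = p :> {mpoly K[7]}.
  by rewrite invrN scaleNr mulNr scalerN opprK invnK.
rewrite (tnth_nth 0).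
by case: j => [[|[|[|[|[|[|[|]]]]]]] lt_j] //; rewrite -yE comp_mpolyZ x_comp //=;
  apply: invnK || apply: invNK.
Qed.

Lemma rho_inv_comp p : (p \mPo rho_inv) \mPo rho_tuple = p.
Proof.
rewrite comp_mpolyA -[RHS]comp_mpoly_id; congr (_ \mPo _).
by apply: eq_from_tnth => j; rewrite !tnth_mktuple rho_invK.
Qed.

Lemma natM_homog n k : n%:R * y_ k \is 1.-homog.
Proof. by rewrite mulr_natl rpredMn // homogXU. Qed.

Lemma rho_homog a : tnth rho_tuple a \is 1.-homog.
Proof.
rewrite (tnth_nth 0).
case: a => [[|[|[|[|[|[|[|[|[|[|[|[|[|[|[|[|]]]]]]]]]]]]]]]] lt_a] //=;
  by rewrite ?rpred0 ?mulNr ?rpredN ?natM_homog.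
Qed.

Lemma rho_inv_homog j : tnth rho_inv j \is 1.-homog.
Proof.
rewrite (tnth_nth 0).
by case: j => [[|[|[|[|[|[|[|]]]]]]] lt_j] //=; rewrite rpredZ // homogXU.
Qed.

Lemma cusp_ideal_homog j : tnth (cusp_ideal K) j \is 2.-homog.
Proof.
have h2 k l : y_ k * y_ l \is 2.-homog by exact: (dhomogM (homogXU _ _) (homogXU _ _)).
have h2n n k l : n%:R * y_ k * y_ l \is 2.-homog.
  by rewrite -mulrA mulr_natl rpredMn ?h2.
have h2s k : y_ k ^+ 2 \is 2.-homog by rewrite expr2 h2.
have h2sn n k : n%:R * y_ k ^+ 2 \is 2.-homog by rewrite mulr_natl rpredMn ?h2s.
rewrite (tnth_nth 0).
by case: j => [[|[|[|[|[|[|[|[|[|[|]]]]]]]]]] lt_j] //=;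
  rewrite rpredD ?rpredB ?h2 ?h2n ?h2s ?h2sn.
Qed.

(** The quadrics are listed in pairs belonging to g_h and g_(h+5): [k./2] is h, and the parity of
    [k] selects the half. *)
Lemma OG_comp_rho k : (k < 10)%N ->
  nth 0 (OG_quadrics K) k \mPo rho_tuple =
  ((-1) ^+ (odd k || odd k./2) * 150) *: nth 0 (cusp_quadrics K) (k./2 + 5 * odd k).
Proof.
have quadE a b c d e f g h :
    all (mem (even_lists : seq (seq nat))) [:: a; b; c; d; e; f; g; h] ->
    (x_ a * x_ b - x_ c * x_ d + x_ e * x_ f - x_ g * x_ h) \mPo rho_tuple =
    let X l := nth 0 rho_tuple (index l even_lists) in
    X a * X b - X c * X d + X e * X f - X g * X h.
  move=> /andP[ha /and5P[hb hc hd he /and4P[hf hg hh _]]].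
  by rewrite comp_mpolyB comp_mpolyD comp_mpolyB !comp_mpolyM !x_comp.
move=> lt_k; rewrite -mul_mpolyC rmorphM rmorphXn rmorphN1 rmorph_nat.
move: k lt_k; do 10?[case=> [_|]] => //=.
all: rewrite quadE //=.
all: rewrite /f0 /f1 /f2 /f3 /f4 /f5 /f6 /f7 /f8 /f9.
all: move: (y_ 0) (y_ 1) (y_ 2) (y_ 3) (y_ 4) (y_ 5) (y_ 6) => y0 y1 y2 y3 y4 y5 y6.
all: ring.
Qed.

(* Row j gives 30 f_j as an integral combination of g_0, ..., g_9. *)
Definition cusp_coefs : seq (seq int) :=
  [:: [:: -3]; [:: 0; 2]; [:: 0; 0; 10]; [:: 0; 0; 0; 0; 12; 0; 0; 0; 0; -150];
      [:: 0; 0; 0; -15]; [:: 0; 0; 0; 0; 6; 0; 0; 0; 0; -60];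
      [:: 0; 0; 0; 0; 0; 0; 0; 30]; [:: 0; 0; 0; 0; 0; 0; 0; 0; 30];
      [:: 0; 0; 0; 0; 0; 0; 30]; [:: 0; 0; 0; 0; 0; 30]].

(** Only f_3 and f_5 are mixed, by an invertible block with g_4 and g_9; each other f_j is a
    rational multiple of one g_k. The factor 30 clears the denominators, and the short rows of
    [cusp_coefs] are padded by the default 0. *)
Lemma cusp_ideal_quadrics j :
  30 *: tnth (cusp_ideal K) j =
  \sum_(k < 10) (nth 0 (nth [::] cusp_coefs j) k)%:~R *: tnth (cusp_quadrics K) k.
Proof.
rewrite -mul_mpolyC rmorph_nat.
under eq_bigr do rewrite -mul_mpolyC rmorph_int (tnth_nth 0).
rewrite !big_ord_recl big_ord0 (tnth_nth 0).
case: j => [[|[|[|[|[|[|[|[|[|[|]]]]]]]]]] lt_j] //=.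
all: rewrite /f0 /f1 /f2 /f3 /f4 /f5 /f6 /f7 /f8 /f9.
all: move: (y_ 0) (y_ 1) (y_ 2) (y_ 3) (y_ 4) (y_ 5) (y_ 6) => y0 y1 y2 y3 y4 y5 y6.
all: ring.
Qed.

Lemma cusp_quadrics_ideal k : in_ideal (C_cusp K) (tnth (cusp_quadrics K) k).
Proof.
have f_ideal j : (j < 10)%N -> in_ideal (C_cusp K) (nth 0 (cusp_ideal K) j).
  by move=> lt_j; apply/in_ideal_gen/mem_nth.
rewrite (tnth_nth 0).
case: k => [[|[|[|[|[|[|[|[|[|[|]]]]]]]]]] lt_k] //=.
- exact: in_idealM (f_ideal 0%N isT).
- exact: in_idealM (f_ideal 1%N isT).
- exact: in_idealM (f_ideal 2%N isT).
- exact: in_idealM (f_ideal 4%N isT).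
- exact: in_idealD (in_idealM _ (f_ideal 3%N isT)) (in_idealM _ (f_ideal 5%N isT)).
- exact: (f_ideal 9%N isT).
- exact: (f_ideal 8%N isT).
- exact: (f_ideal 6%N isT).
- exact: (f_ideal 7%N isT).
- exact: in_idealD (in_idealN (f_ideal 3%N isT)) (in_idealM _ (f_ideal 5%N isT)).
Qed.

(** * The span L in coordinates *)

Lemma eSE l (a : 'I_16) : l \in (even_lists : seq (seq nat)) ->
  eS K l 0 a = (a == index l even_lists :> nat)%:R.
Proof.
move=> l_even; rewrite mxE eqxx /= -val_eqE /= inordK //.
by rewrite -[X in (_ < X)%N](size_tuple even_lists) index_mem.
Qed.

(** Read off at the seven coordinates used by [rho_inv], each of which occurs in one basis vector of
    L only, with coefficient 1. *)
Definition basis_scale : seq K := [:: 50; - 150; - 120; - 5; - 9; 15; 10].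
Definition basis_coord : seq nat := [:: 4; 5; 6; 0; 1; 2; 3]%N.

Lemma eval_rho w : eval_tuple rho_tuple w =
  \sum_(k < 7) (nth 0 basis_scale k * w 0 (inord (nth 0%N basis_coord k))) *:
    nth 0 (L_cusp_basis K) k.
Proof.
(* The entries of [w] become atoms for [field]. *)
have [z zE] : exists z, forall k, w 0 (inord k) = z k by exists (w 0 \o inord).
have evM n k : eval_at (n%:R * y_ k) w = n%:R * z k.
  by rewrite /eval_at mevalM rmorph_nat mevalXU zE.
have evNM n k : eval_at (- n%:R * y_ k) w = - n%:R * z k.
  by rewrite /eval_at mulNr mevalN -/(eval_at _ _) evM mulNr.
have ev0 : eval_at 0 w = 0 by rewrite /eval_at meval0.
apply/rowP => a; rewrite summxE [LHS]mxE (tnth_nth 0) !big_ord_recl big_ord0.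
have eE l := @eSE l a.
rewrite /L_cusp_basis /= !zE; move: (eS K) eE => e eE; rewrite !mxE !eE //.
case: a {eE} => [[|[|[|[|[|[|[|[|[|[|[|[|[|[|[|[|]]]]]]]]]]]]]]]] lt_a] //=.
all: rewrite ?(evM, evNM, ev0).
all: by field; rewrite ?natr_neq0.
Qed.

Lemma L_cuspP v : v \in L_cusp K <-> exists w, v = eval_tuple rho_tuple w.
Proof.
split=> [vL|[w ->]]; last first.
  rewrite eval_rho; apply: rpred_sum => k _; apply: rpredZ.
  by apply/memv_span/mem_nth.
have nth_scale (k : 'I_7) : nth 0 basis_scale k != 0.
  by case: k => [[|[|[|[|[|[|[|]]]]]]] lt_k] //=; rewrite ?oppr_eq0 natr_neq0.
have [c cE] : exists c : nat -> K, forall k : 'I_7,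
    coord (in_tuple (L_cusp_basis K)) k v = nth 0 basis_scale k * c k.
  exists (fun k => coord (in_tuple (L_cusp_basis K)) (inord k) v / nth 0 basis_scale k).
  by move=> k; rewrite inord_val mulrC divfK.
(* The list inverts the permutation [basis_coord]. *)
exists (\row_j nth 0 [:: c 3; c 4; c 5; c 6; c 0; c 1; c 2]%N j).
rewrite eval_rho (@coord_span _ _ _ (in_tuple (L_cusp_basis K)) v vL); apply: eq_bigr => k _.
rewrite cE mxE; congr (_ * _ *: _).
by case: k => [[|[|[|[|[|[|[|]]]]]]] lt_k] //=; rewrite inordK.
Qed.

Lemma eval_rho_inv w : eval_tuple rho_inv (eval_tuple rho_tuple w) = w.
Proof.
apply/rowP => j; rewrite mxE -eval_at_comp rho_invK //.
by rewrite /eval_at mevalXU.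
Qed.

(** * The half spinor at a smooth point *)

Lemma W_perp_annihilates p : is_point (C_cusp K) p ->
  annihilates (W_perp p) (spinor (eval_tuple rho_tuple p)).
Proof.
move=> Cp; apply: annihilates_rows => i; apply/ffunP => J.
have /(congr1 (fun q : {mpoly K[7]} => eval_at q^`M(i) p)) := cusp_syzygy J.
rewrite mderiv0 {2}/eval_at meval0 ffunE => <-.
rewrite spin_actionE eval_mderiv_sum; apply: eq_bigr => j _.
rewrite mderivM /eval_at mevalD !mevalM -!/(eval_at _ _).
(* The Leibniz term with the derivative of [rho_coef] drops out, since its other factor g_k vanishes
   at [p]. *)
rewrite (in_ideal_eval Cp (cusp_quadrics_ideal _)) mul0r addr0.
by rewrite /eval_at mevalZ spinor_rho !mxE.
Qed.

(** Smoothness is tested on the f_j, whereas [W_perp] comes from the g_k; as the f_j are constant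
    combinations of the g_k, one Jacobian is the other times a constant matrix. *)
Lemma rank_jacobian_W_perp p :
  (\rank (jacobian (cusp_ideal K) p) <= \rank (W_perp p))%N.
Proof.
pose M : 'M[K]_10 := \matrix_(k, j) (nth 0 (nth [::] cusp_coefs j) k)%:~R.
have -> : jacobian (cusp_ideal K) p = 30^-1 *: (W_perp p *m M).
  apply/matrixP => i j; rewrite !mxE.
  have /(congr1 (fun q : {mpoly K[7]} => eval_at q^`M(i) p)) := cusp_ideal_quadrics j.
  rewrite mderivZ {1}/eval_at mevalZ -/(eval_at _ _) => /(canRL (mulKf (natr_neq0 29))) ->.
  congr (_ * _); rewrite eval_mderiv_sum; apply: eq_bigr => k _.
  by rewrite mderivZ /eval_at mevalZ !mxE mulrC.
by apply: leq_trans (mxrankM_maxl _ M); apply/mxrankS/scalemx_sub.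
Qed.

Lemma eval_rho_neq0 v : v != 0 -> eval_tuple rho_tuple v != 0.
Proof.
apply: contraNneq => rho0; rewrite -[v]eval_rho_inv rho0.
by rewrite eval_tuple_linear0 //; apply: rho_inv_homog.
Qed.

Lemma rho_eqP p x : is_smooth_C_cusp p ->
  rho_eq p x <-> has_value [:: rho_tuple] p x.
Proof.
move=> [Cp rk_p].
have rho_p0 := eval_rho_neq0 Cp.1.
(* The Jacobian criterion gives rank [7 - 2]. *)
have rkW : (5 <= \rank (W_perp p))%N.
  by apply: leq_trans (rank_jacobian_W_perp p); rewrite rk_p.
split=> [[x0 Wx]|[t [/[!inE]/eqP-> _ [c c0 ->]]]].
  exists rho_tuple; split; rewrite ?mem_head //.
  have [|c def_x] := annihilates_unique rkW _ (W_perp_annihilates Cp) Wx.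
    by rewrite spinor_eq0.
  exists c; last by apply: spinor_inj; rewrite spinorZ.
  apply: contraNneq x0 => c0; rewrite -spinor_eq0 def_x c0 scale0r //.
split; first by rewrite scaler_eq0 negb_or c0.
by move=> u uW; rewrite spinorZ spin_actionZ (W_perp_annihilates Cp) // scaler0.
Qed.

(** * The image and the linear section as schemes *)

Local Notation image := (image_subscheme C [:: rho_tuple]).
Local Notation linear_section := (cap_subscheme (P_cusp K) (OG K)).

(** [rho_tuple] takes its values in L, so the pullback is a linear form that vanishes at every
    vector. *)
Lemma P_cusp_comp p : P_cusp K p -> p \mPo rho_tuple = 0.
Proof.
move=> [hp p0]; apply: linear_form_eq0; first exact: dhomog_comp_linear rho_homog hp.
by move=> v; rewrite eval_at_comp p0 //; apply/L_cuspP => //; exists v.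
Qed.

(** These equations define the fixed locus of the linear projection [rho_tuple] after [rho_inv],
    which is L. *)
Definition retract_eq a : {mpoly K[16]} := 'X_a - (tnth rho_tuple a \mPo rho_inv).

Lemma retract_eq_homog a : retract_eq a \is 1.-homog.
Proof.
by rewrite rpredB ?homogXU ?dhomog_comp_linear ?rho_homog //; apply: rho_inv_homog.
Qed.

Lemma retract_eq_comp a : retract_eq a \mPo rho_tuple = 0.
Proof. by rewrite comp_mpolyB tnth_comp_mpolyXU rho_inv_comp // subrr. Qed.

Lemma P_cusp_retract a : P_cusp K (retract_eq a).
Proof.
split=> [|v /L_cuspP[w ->]]; first exact: retract_eq_homog.
rewrite /eval_at mevalB -!/(eval_at _ _) eval_at_comp eval_rho_inv //.
by rewrite /eval_at mevalXU mxE subrr.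
Qed.

Lemma image_retract a : image (retract_eq a).
Proof.
split; first by exists 1%N; apply: retract_eq_homog.
by move=> t; rewrite inE => /eqP ->; rewrite retract_eq_comp; apply: in_saturation0.
Qed.

Lemma image_pullback j : image (tnth (cusp_ideal K) j \mPo rho_inv).
Proof.
split.
  exists 2%N; apply: dhomog_comp_linear; last exact: cusp_ideal_homog.
  exact: rho_inv_homog.
move=> t; rewrite inE => /eqP ->; rewrite rho_inv_comp //.
exact/in_saturation_ideal/in_ideal_gen/mem_tnth.
Qed.

(** The equations [retract_eq] hold at [v], so [v] is recovered linearly from its value under
    [rho_inv]. *)
Lemma image_point_inv v : is_point image v -> eval_tuple rho_inv v != 0.
Proof.
move=> [v0 Yv]; apply: contraNneq v0 => inv0; apply/eqP/rowP => a.
have := Yv _ (image_retract a).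
rewrite /eval_at mevalB mevalXU -/(eval_at _ _) eval_at_comp inv0 => /eqP.
rewrite subr_eq0 => /eqP ->.
have /rowP/(_ a) := eval_tuple_linear0 rho_homog; rewrite !mxE => ->.
by [].
Qed.

Lemma rho_embedding : is_embedding C [:: rho_tuple].
Proof.
split.
- apply: linear_morphism => [|v [v0 _]]; [exact: rho_homog | exact: eval_rho_neq0].
- by move=> t G tP [_ GP]; apply: GP.
exists [:: rho_inv]; split.
- apply: linear_morphism => [|v]; [exact: rho_inv_homog | exact: image_point_inv].
- move=> t G; rewrite inE => /eqP -> /tnthP[j ->].
  exact/in_saturation_ideal/in_ideal_gen/image_pullback.
- move=> t u; rewrite !inE => /eqP -> /eqP -> i j.
  rewrite !tnth_mktuple !rho_invK // mulrC subrr; exact: in_saturation0.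
- move=> t u; rewrite !inE => /eqP -> /eqP -> i j.
  rewrite !tnth_mktuple; apply: in_saturation_ideal.
  set p := _ \mPo _; set q := _ \mPo _.
  (* Modulo [retract_eq], [p] is ['X_i] and [q] is ['X_j], so the minor becomes trivial. *)
  have -> : p * 'X_j - q * 'X_i = 'X_i * retract_eq j - 'X_j * retract_eq i.
    rewrite /retract_eq -/p -/q; ring.
  by apply: in_idealD; last apply: in_idealN; apply/in_idealM/in_ideal_gen/image_retract.
Qed.

Lemma OG_homog q : OG K q -> q \is 2.-homog.
Proof.
have hx l l' : x_ l * x_ l' \is 2.-homog.
  exact: dhomogM (homogXU _ _) (homogXU _ _).
have hq a b c d e f g h : x_ a * x_ b - x_ c * x_ d + x_ e * x_ f
    - x_ g * x_ h \is 2.-homog.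
  by do 3?[apply: rpredB | apply: rpredD]; apply: hx.
move=> /(nthP 0)[k lt_k <-]; move: k lt_k.
do 10?[case=> [_|]] => //=.
all: exact: hq.
Qed.

Lemma linear_section_image G : linear_section G -> image G.
Proof.
move=> [PG|OG_G]; split.
- by exists 1%N; case: PG.
- by move=> t; rewrite inE => /eqP ->; rewrite P_cusp_comp //; apply: in_saturation0.
- exists 2%N; exact: OG_homog.
- move=> t; rewrite inE => /eqP ->; apply: in_saturation_ideal.
  have /(nthP 0)[k lt_k <-] := OG_G.
  rewrite OG_comp_rho //; apply: in_idealZ.
  have lt_k' : (k./2 + 5 * odd k < 10)%N by move: k lt_k {OG_G G}; do 10?[case=> //].
  by have := cusp_quadrics_ideal (Ordinal lt_k'); rewrite (tnth_nth 0).
Qed.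

(** Modulo the equations of P(L) the projection fixes every variable, hence every polynomial. *)
Lemma section_retract p : in_ideal linear_section (p - ((p \mPo rho_tuple) \mPo rho_inv)).
Proof.
rewrite comp_mpolyA; apply: in_ideal_subst => a; rewrite tnth_mktuple.
by apply: in_ideal_gen; left; apply: P_cusp_retract.
Qed.

(** A quadric of OG(5,10) pulls back to a nonzero multiple of g_k, and its round trip returns that
    quadric modulo P(L). *)
Lemma section_pullback_quadric k :
  in_ideal linear_section (tnth (cusp_quadrics K) k \mPo rho_inv).
Proof.
(* [l] is the position of the quadric matched with g_k in [OG_comp_rho]. *)
pose l : nat := if (k < 5)%N then (2 * k)%N else (2 * (k - 5)).+1.
have [lt_l def_k] : (l < 10)%N /\ (l./2 + 5 * odd l = k)%N.
  by rewrite /l; case: k {l} => [[|[|[|[|[|[|[|[|[|[|]]]]]]]]]] lt_k].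
have := OG_comp_rho lt_l; rewrite def_k -tnth_nth.
set c := (_ * _ : K).
have c0 : c != 0 by rewrite mulf_neq0 ?signr_eq0 ?natr_neq0.
move=> /esym/(canRL (scalerK c0)) ->; rewrite comp_mpolyZ; apply: in_idealZ.
set q := nth _ _ _.
have -> : (q \mPo rho_tuple) \mPo rho_inv = q - (q - ((q \mPo rho_tuple) \mPo rho_inv)) by ring.
apply: in_idealD; last exact/in_idealN/section_retract.
by apply: in_ideal_gen; right; apply: mem_nth.
Qed.

Lemma section_pullback p : in_ideal C p -> in_ideal linear_section (p \mPo rho_inv).
Proof.
apply: in_ideal_comp => _ /tnthP[j ->].
have := cusp_ideal_quadrics j => /(canRL (scalerK (natr_neq0 29))) ->.
rewrite comp_mpolyZ rmorph_sum; apply/in_idealZ/in_ideal_sum => k _ /=.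
rewrite comp_mpolyZ; exact/in_idealZ/section_pullback_quadric.
Qed.

(** A monomial of degree [N] pulls back to a form of degree [N], a combination of monomials to each
    of which [CN] applies; the round trip then returns ['X_[m] * G] modulo P(L). *)
Lemma image_sub_section G : image G -> in_saturation linear_section G.
Proof.
move=> [_ /(_ rho_tuple (mem_head _ _))[N CN]]; exists N => m mN.
rewrite -['X_[m] * G](subrK ((('X_[m] * G) \mPo rho_tuple) \mPo rho_inv)).
apply: in_idealD; first exact: section_retract.
apply: section_pullback; rewrite comp_mpolyM.
have : 'X_[m] \mPo rho_tuple \is N.-homog.
  apply: dhomog_comp_linear; first exact: rho_homog.
  by rewrite dhomogX; apply/eqP.
move=> /dhomogP hm; rewrite ['X_[m] \mPo _]mpolyE mulr_suml big_seq.
apply: in_ideal_sum => q /hm qN; rewrite -scalerAl; apply: in_idealZ.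
exact: CN.
Qed.

Lemma rho_image : same_subscheme image linear_section.
Proof.
move=> p; split; first exact/in_saturation_trans/image_sub_section.
exact/sub_in_saturation/linear_section_image.
Qed.

End CuspidalSpinors.

Theorem proposition3p1 (R : realType) :
  exists rho_bar : seq (16.-tuple {mpoly R[i][7]}),
    [/\ is_morphism (C_cusp R[i]) rho_bar,
        forall p : 'rV[R[i]]_7, is_smooth_C_cusp p ->
          forall x : 'rV[R[i]]_16, rho_eq p x <-> has_value rho_bar p x,
        is_embedding (C_cusp R[i]) rho_bar
      & same_subscheme (image_subscheme (C_cusp R[i]) rho_bar)
          (cap_subscheme (P_cusp R[i]) (OG R[i]))].
Proof.
have char0 : [pchar R[i]] =i pred0 by exact: pchar_num.
exists [:: rho_tuple R[i]]; split.
- by case: (rho_embedding char0).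
- by move=> p smooth_p x; apply: rho_eqP.
- exact: rho_embedding.
- exact: rho_image.
Qed.
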